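(* Let $H_1,H_2$ be complex Hilbert spaces, let $A_1\in B(H_1)$ and $A_2\in B(H_2)$ be positive (semidefinite) operators, and let $T_1\in B_{A_1^{1/2}}(H_1)$, $T_2\in B_{A_2^{1/2}}(H_2)$. Then $$\sigma_{(A_1)_{app}}(T_1)\,\sigma_{(A_2)_{app}}(T_2)\subset\sigma_{(A_1\otimes A_2)_{app}}(T_1\otimes T_2),$$ where the left-hand side is the set of products $\{\lambda_1\lambda_2:\lambda_1\in\sigma_{(A_1)_{app}}(T_1),\ \lambda_2\in\sigma_{(A_2)_{app}}(T_2)\}$.
   Context: $B(H)$ is the algebra of bounded linear operators on $H$; $R(\cdot)$ denotes range. For a positive semidefinite $A\in B(H)$: $\|x\|_A=\langle Ax,x\rangle^{1/2}$; $B_{A^{1/2}}(H)=\{T\in B(H): R(T^*A^{1/2})\subset R(A^{1/2})\}$ (equivalently, there is $d>0$ with $\|Tx\|_A\le d\|x\|_A$ for all $x\in H$); and for $T\in B(H)$, $\sigma_{A_{app}}(T)$ is the set of $\lambda\in\mathbb C$ for which there is a sequence $\{x_n\}$ in $H$ with $\|x_n\|_A=1$ for all $n$ and $\|(T-\lambda)x_n\|_A\to0$. $H_1\otimes H_2$ is the Hilbert space tensor product, i.e. the completion of the algebraic tensor product $H_1\odot H_2$ (the linear span of elementary tensors $x\otimes y$) in the inner product determined by $(x\otimes y,x'\otimes y')=\langle x,x'\rangle\langle y,y'\rangle$. $T_1\otimes T_2$ is the bounded operator on $H_1\otimes H_2$ extending $x\otimes y\mapsto T_1x\otimes T_2y$;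 $A_1\otimes A_2$ is defined likewise. *)

(* Defs.v *)
From HB Require Import structures.
From mathcomp Require Import all_boot all_order all_algebra sesquilinear.
From mathcomp Require Import complex.
From mathcomp Require Import all_classical all_reals all_analysis.

Set Implicit Arguments.
Unset Strict Implicit.
Unset Printing Implicit Defensive.

Import Order.TTheory GRing.Theory Num.Theory.
Import numFieldNormedType.Exports.

Local Open Scope classical_set_scope.
Local Open Scope ring_scope.
Local Open Scope complex_scope.

(* A complex Hilbert space is a complete normed space over R[i] whose norm
   comes from an inner product, linear in its first argument.  The norm of a
   normed module over R[i] takes its values in R[i]; its positive definiteness
   gives that of the inner product. *)
HB.mixin Record isHilbert (R : realType) H & CompleteNormedModule R[i] H := {
  hdot : H -> H -> R[i] ;
  hdotDl : forall x y z : H, hdot (x + y) z = hdot x z + hdot y z ;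
  hdotZl : forall (a : R[i]) (x y : H), hdot (a *: x) y = a * hdot x y ;
  hdotC : forall x y : H, hdot x y = (hdot y x)^* ;
  hdot_norm : forall x : H, hdot x x = `|x| ^+ 2
}.

#[short(type="hilbertType")]
HB.structure Definition Hilbert (R : realType) :=
  {H of CompleteNormedModule R[i] H & isHilbert R H}.

Section Operators.
Context {R : realType} {H : hilbertType R}.
Implicit Types (A S T : {linear H -> H}) (x y : H).

Definition bounded_op T : Prop := bounded_near T (nbhs (0 : H)).

(* In R[i], [0 <= z] means that z is real and nonnegative. *)
Definition positive_op A : Prop := forall x, 0 <= hdot (A x) x.

Definition is_adjoint T T' : Prop :=
  forall x y, hdot (T x) y = hdot x (T' y).

(* S = A^{1/2} *)
Definition is_sqrt_op A S : Prop :=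
  [/\ bounded_op S, positive_op S & forall x, S (S x) = A x].

(* T belongs to B_{A^{1/2}}(H).  Both A^{1/2} and T^* exist and are unique
   when A is positive and A, T are bounded. *)
Definition in_B_sqrt A T : Prop :=
  exists S T' : {linear H -> H},
    [/\ is_sqrt_op A S, bounded_op T', is_adjoint T T' &
        range (fun x => T' (S x)) `<=` range S].

(* For positive A the inner product is real, so Re loses nothing; it makes
   the seminorm R-valued. *)
Definition opnorm A x : R := Num.sqrt (complex.Re (hdot (A x) x)).

Definition app_spectrum A T : set R[i] :=
  [set l | exists x : nat -> H,
     (forall n, opnorm A (x n) = 1) /\
     opnorm A (T (x n) - l *: x n) @[n --> \oo] --> (0 : R)].

End Operators.

Section TensorProduct.
Context {R : realType} {H1 H2 H : hilbertType R}.
Implicit Types tens : {bilinear H1 -> H2 -> H}.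

(* The linear span of the elementary tensors (scalars are absorbed in the
   first factor). *)
Definition tensor_span tens : set H :=
  [set \sum_(p <- s) tens p.1 p.2 | s in [set: seq (H1 * H2)]].

(* The Hilbert space H, with elementary tensors [tens x y], is the completion
   of the algebraic tensor product for the product inner product: H is
   complete, the inner product of H has the prescribed values on elementary
   tensors, and these span a dense subspace.  This determines (H, tens) up to
   a unique unitary isomorphism. *)
Definition is_hilbert_tensor tens : Prop :=
  (forall x x' y y', hdot (tens x y) (tens x' y') = hdot x x' * hdot y y') /\
  dense (tensor_span tens).

(* T is the operator T1 (x) T2; it is unique by density of the span. *)
Definition is_tensor_op tens (T1 : {linear H1 -> H1}) (T2 : {linear H2 -> H2})
    (T : {linear H -> H}) : Prop :=
  bounded_op T /\ forall x y, T (tens x y) = tens (T1 x) (T2 y).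

End TensorProduct.

(* Main.v *)
Require Import Defs.
From mathcomp Require Import all_boot all_order all_algebra sesquilinear.
From mathcomp Require Import complex.
From mathcomp Require Import all_classical all_reals all_analysis ring lra.

(* If x_n and y_n are approximate eigenvectors for l1 and l2, then so are the
   tensors x_n (x) y_n for l1 * l2.  With u_n = (T1 - l1) x_n and
   v_n = (T2 - l2) y_n,
     T (x_n (x) y_n) - l1 l2 x_n (x) y_n
       = u_n (x) v_n + u_n (x) l2 y_n + l1 x_n (x) v_n,
   and the A-seminorm of a sum of elementary tensors a (x) b is at most the sum
   of the products |a|_A1 |b|_A2, so it tends to 0. *)

Import Order.TTheory GRing.Theory Num.Theory.
Import numFieldNormedType.Exports.

Local Open Scope classical_set_scope.
Local Open Scope ring_scope.

Section Hdot.
Context {R : realType} {H : hilbertType R}.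
Implicit Types (x y z : H) (a : R[i]).

Lemma hdotDr z x y : hdot z (x + y) = hdot z x + hdot z y.
Proof. by rewrite hdotC hdotDl rmorphD /= -!hdotC. Qed.

Lemma hdotZr a x y : hdot x (a *: y) = (a^*)%C * hdot x y.
Proof. by rewrite hdotC hdotZl rmorphM /= -hdotC. Qed.

Lemma hdot0l y : hdot (0 : H) y = 0.
Proof. by rewrite -(scale0r (0 : H)) hdotZl mul0r. Qed.

Lemma hdot0r y : hdot y (0 : H) = 0.
Proof. by rewrite hdotC hdot0l rmorph0. Qed.

Lemma hdot_suml I (s : seq I) (F : I -> H) y :
  hdot (\sum_(i <- s) F i) y = \sum_(i <- s) hdot (F i) y.
Proof.
exact: (big_morph (fun x => hdot x y) (fun _ _ => hdotDl _ _ _) (hdot0l y)).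
Qed.

Lemma hdot_sumr I (s : seq I) (F : I -> H) y :
  hdot y (\sum_(i <- s) F i) = \sum_(i <- s) hdot y (F i).
Proof. exact: (big_morph (hdot y) (hdotDr y) (hdot0r y)). Qed.

End Hdot.

(** Discriminant step of the Cauchy-Schwarz inequality, where [N] is the squared modulus of the
    cross term. The value [s = q] settles [q > 0], since the quadratic is then [q * (p * q - N)]. *)
Lemma quadratic_discr (R : realFieldType) (p q N : R) :
  0 <= q -> 0 <= p -> 0 <= N ->
  (forall s, 0 <= s ^+ 2 * p - s * N *+ 2 + N * q) -> N <= p * q.
Proof.
move=> q0 p0 N0 h.
have [q_eq0|qn0] := eqVneq q 0; last first.
  have {h} := h q.
  have qgt : 0 < q by rewrite lt_def qn0.
  have -> : q ^+ 2 * p - q * N *+ 2 + N * q = q * (p * q - N) by ring.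
  by rewrite pmulr_rge0 // subr_ge0.
(* For [q = 0] this [s] makes the quadratic negative as soon as [N > 0]; the [+ 1] keeps the
   denominator positive when [p = 0]. *)
have {h} := h (N / (p + 1)).
rewrite q_eq0 !mulr0 addr0 leNgt.
apply: contraNT; rewrite -ltNge => Ngt.
have p1 : 0 < p + 1 by rewrite ltr_wpDl.
have -> : (N / (p + 1)) ^+ 2 * p - N / (p + 1) * N *+ 2
   = - ((N / (p + 1)) ^+ 2 * (p + 2)) by field; rewrite gt_eqF.
by rewrite oppr_lt0 mulr_gt0 ?exprn_gt0 ?divr_gt0 // ltr_wpDl.
Qed.

Section PositiveOperator.
Context {R : realType} {H : hilbertType R}.
Variable A : {linear H -> H}.
Hypothesis A_pos : positive_op A.
Implicit Types x y : H.

Lemma opnorm_ge0 x : 0 <= opnorm A x.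
Proof. exact: sqrtr_ge0. Qed.

Lemma sqr_opnorm x : ((opnorm A x) ^+ 2)%:C%C = hdot (A x) x.
Proof.
have := A_pos x; rewrite /opnorm; case: (hdot _ _) => a b.
by rewrite lecE /= => /andP[/eqP -> a0]; rewrite sqr_sqrtr.
Qed.

(* Polarization: [hdot (A z) z] is real for z = x + y and for z = x + i y. *)
Lemma positive_op_sym x y : hdot (A x) y = ((hdot (A y) x)^*)%C.
Proof.
have real_form z : ((hdot (A z) z)^*)%C = hdot (A z) z.
  by rewrite -sqr_opnorm conjc_real.
have h1 := real_form (x + y).
have hi := real_form (x + 'i%C *: y).
move: h1 hi.
rewrite !linearD !linearZ /= !hdotDl !hdotDr !hdotZl !hdotZr.
rewrite -!sqr_opnorm.
case: (hdot (A x) y) => a b; case: (hdot (A y) x) => c d.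
simpc; move=> [h1] [h2]; apply/eqP; rewrite eq_complex /=.
apply/andP; split; apply/eqP; lra.
Qed.

Lemma positive_op_CauchySchwarz x y :
  `|hdot (A x) y| <= (opnorm A x * opnorm A y)%:C%C.
Proof.
set a := hdot (A x) y.
have N_ge0 : 0 <= complex.Re a ^+ 2 + complex.Im a ^+ 2.
  by rewrite addr_ge0 ?sqr_ge0.
have aE : a * (a^*)%C = (complex.Re a ^+ 2 + complex.Im a ^+ 2)%:C%C.
  by case: (a) => u v; simpc; congr (_ +i* _)%C; ring.
rewrite -(@ler_pXn2r _ 2) ?nnegrE ?normr_ge0 //; last first.
  by rewrite lecR mulr_ge0 ?opnorm_ge0.
rewrite sqr_normc aE {aE} -rmorphXn /= lecR exprMn.
apply: quadratic_discr; rewrite ?sqr_ge0 // => s.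
(* The coefficient [- a] aligns the phases: the two cross terms add up to [- 2 s |a|^2], which is
   real, and the form becomes the quadratic in [s] with [N = |a|^2]. *)
have := A_pos (s%:C%C *: x + (- a) *: y).
rewrite linearD !linearZ /= !hdotDl !hdotDr !hdotZl !hdotZr.
rewrite (positive_op_sym y x) -/a -!sqr_opnorm.
rewrite -lecR; congr (_ <= _); case: (a) => u v; simpc.
apply/eqP; rewrite eq_complex /=.
by apply/andP; split; apply/eqP; ring.
Qed.

Lemma opnormZ (l : R[i]) x : opnorm A (l *: x) = complex.Re `|l| * opnorm A x.
Proof.
rewrite /opnorm linearZ hdotZl hdotZr mulrA -sqr_normc -sqr_opnorm.
rewrite normc_def -rmorphXn -rmorphM /= sqrtrM ?sqr_ge0 //.
by rewrite !sqrtr_sqr ger0_norm // sqrtr_ge0.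
Qed.

End PositiveOperator.

Section TensorOperator.
Context {R : realType} {H1 H2 H : hilbertType R}.
Variable tens : {bilinear H1 -> H2 -> H}.
Hypothesis hdot_tens : forall x x' y y',
  hdot (tens x y) (tens x' y') = hdot x x' * hdot y y'.
Variables (A1 : {linear H1 -> H1}) (A2 : {linear H2 -> H2}) (A : {linear H -> H}).
Hypotheses (A1_pos : positive_op A1) (A2_pos : positive_op A2).
Hypothesis A_tens : forall x y, A (tens x y) = tens (A1 x) (A2 y).

(** On an elementary tensor the form of [A] is a product of two nonnegative reals, so its square
    root splits. *)
Lemma opnorm_tens x y : opnorm A (tens x y) = opnorm A1 x * opnorm A2 y.
Proof.
rewrite {1}/opnorm A_tens hdot_tens -!sqr_opnorm // -rmorphM /= -exprMn sqrtr_sqr.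
by rewrite ger0_norm // mulr_ge0 ?opnorm_ge0.
Qed.

(* A need not be known to be positive on H: Cauchy-Schwarz for A1 and A2
   bounds each cross term of the expanded quadratic form. *)
Lemma opnorm_tens_sum (s : seq (H1 * H2)) :
  opnorm A (\sum_(p <- s) tens p.1 p.2)
    <= \sum_(p <- s) opnorm A1 p.1 * opnorm A2 p.2.
Proof.
have sum_ge0 : 0 <= \sum_(p <- s) opnorm A1 p.1 * opnorm A2 p.2.
  by apply: sumr_ge0 => p _; rewrite mulr_ge0 ?opnorm_ge0.
(* [Num.sqrt] is 0 on negative reals, hence monotone on all of [R]; it remains to bound the real
   part of the form by the square of the right-hand side. *)
rewrite -[leRHS]ger0_norm // -sqrtr_sqr ler_wsqrtr //.
rewrite -lecR; set z := hdot _ _.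
apply: (@le_trans _ _ `|z|).
  by apply: le_trans (normc_ge_Re z); rewrite lecR ler_norm.
(* Both sides expand into double sums over pairs [p], [q], compared term by term. *)
rewrite {}/z linear_sum hdot_suml expr2 mulr_suml rmorph_sum.
apply: le_trans (ler_norm_sum _ _ _) _; apply: ler_sum => p _.
rewrite hdot_sumr mulr_sumr rmorph_sum.
apply: le_trans (ler_norm_sum _ _ _) _; apply: ler_sum => q _.
rewrite A_tens hdot_tens normrM mulrACA rmorphM /=.
by apply: ler_pM; rewrite ?normr_ge0 // positive_op_CauchySchwarz.
Qed.

End TensorOperator.

Theorem theorem3p1 (R : realType) (H1 H2 H : hilbertType R)
  (tens : {bilinear H1 -> H2 -> H}) (tensP : is_hilbert_tensor tens)
  (A1 T1 : {linear H1 -> H1}) (A2 T2 : {linear H2 -> H2})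
  (A1_bounded : bounded_op A1) (A1_pos : positive_op A1)
  (A2_bounded : bounded_op A2) (A2_pos : positive_op A2)
  (T1_bounded : bounded_op T1) (T1_B : in_B_sqrt A1 T1)
  (T2_bounded : bounded_op T2) (T2_B : in_B_sqrt A2 T2)
  (A T : {linear H -> H})
  (A_tens : is_tensor_op tens A1 A2 A) (T_tens : is_tensor_op tens T1 T2 T) :
  [set l1 * l2 | l1 in app_spectrum A1 T1 & l2 in app_spectrum A2 T2]
    `<=` app_spectrum A T.
Proof.
move: tensP A_tens T_tens => [hdot_tens _] [_ AE] [_ TE].
move=> _ [l1 [x [x1 xcvg]] [l2 [y [y1 ycvg]] <-]].
exists (fun n => tens (x n) (y n)); split => [n|].
  by rewrite (opnorm_tens _ hdot_tens _ _ _ A1_pos A2_pos AE) x1 y1 mulr1.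
pose u n := T1 (x n) - l1 *: x n; pose v n := T2 (y n) - l2 *: y n.
pose p n := opnorm A1 (u n); pose q n := opnorm A2 (v n).
(* The modulus of [l] as an element of [R], since the norm of [R[i]] is itself complex-valued. *)
pose c (l : R[i]) := complex.Re `|l|.
apply: (@squeeze_cvgr _ _ _ _ (cst 0)
  (fun n => p n * q n + p n * c l2 + c l1 * q n)).
- apply: nearW => n; rewrite opnorm_ge0 /=.
  have -> : T (tens (x n) (y n)) - l1 * l2 *: tens (x n) (y n) =
      \sum_(r <- [:: (u n, v n); (u n, l2 *: y n); (l1 *: x n, v n)])
        tens r.1 r.2.
    rewrite !big_cons big_nil addr0 /= TE.
    (* The first two tensors merge into [tens (u n) (T2 (y n))]; then the terms
       [tens (l1 *: x n) (T2 (y n))] cancel. *)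
    rewrite /u /v addrA -linearDr subrK linearBl linearBr addrA subrK.
    by rewrite linearZl_LR linearZr_LR /= scalerA.
  apply: le_trans (opnorm_tens_sum _ hdot_tens _ _ _ A1_pos A2_pos AE _) _.
  by rewrite !big_cons big_nil addr0 /= !opnormZ // x1 y1 !mulr1 addrA.
- exact: cvg_cst.
- have -> : 0 = 0 * 0 + 0 * c l2 + c l1 * 0 :> R by rewrite !mul0r mulr0 !addr0.
  apply: cvgD; first apply: cvgD.
  + exact: cvgM.
  + by apply: cvgM => //; exact: cvg_cst.
  + by apply: cvgM => //; exact: cvg_cst.
Qed.
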